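(* Assume exactness and $\mathbf{A}\neq 0$. Let $x^0\in\mathbb{R}^n$, $x^*=\Pi_{\mathcal{L},\mathbf{B}}(x^0)$. At iteration $k$, with $\mathbf{M}_k=\mathbf{S}_k^\top\mathbf{A}\mathbf{B}^{-1}\mathbf{A}^\top\mathbf{S}_k$, $d_k=\mathbf{S}_k^\top(b-\mathbf{A}x^k)$ and $\lambda^k_*=\mathbf{M}_k^\dagger d_k$, let $\lambda^k_r$ be the output of $r$ steps of some iterative method started at $\lambda^k_0=0$, satisfying $$\mathbb{E}\big[\|\lambda_r^k-\lambda_*^k\|_{\mathbf{M}_k}^2\mid x^k,\mathbf{S}_k\big]\le\rho_{\mathbf{S}_k}^r\|\lambda_0^k-\lambda_*^k\|_{\mathbf{M}_k}^2,$$ where $\rho_{\mathbf{S}_k}\in(0,1)$, and assume there is $\theta<1$ with $\rho_{\mathbf{S}_k}\le\theta$ almost surely. Set $x^{k+1}=x^k+\mathbf{B}^{-1}\mathbf{A}^\top\mathbf{S}_k\lambda_r^k$ (unit stepsize). Then for all $k\ge0$ $$\mathbb{E}[\|x^k-x^*\|_{\mathbf{B}}^2]\le\big[1-(1-\theta^r)\lambda_{\min}^+\big]^k\|x^0-x^*\|_{\mathbf{B}}^2 .$$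
   Context: Let $\mathbf{A}\in\mathbb{R}^{m\times n}$ and $b\in\mathbb{R}^m$ be such that the linear system $\mathbf{A}x=b$ is consistent, and let $\mathcal{L}=\{x\in\mathbb{R}^n:\mathbf{A}x=b\}$. Let $\mathbf{B}\in\mathbb{R}^{n\times n}$ be symmetric positive definite, $\|x\|_{\mathbf{B}}=\sqrt{x^\top\mathbf{B}x}$, $\|v\|_{\mathbf{M}}^2=v^\top\mathbf{M}v$ for positive semidefinite $\mathbf{M}$, and $\Pi_{\mathcal{L},\mathbf{B}}(x)=\arg\min_{x'\in\mathcal{L}}\|x'-x\|_{\mathbf{B}}$. Let $\mathcal{D}$ be a probability distribution over random real matrices $\mathbf{S}$ with $m$ rows (any number of columns). For $\mathbf{S}\sim\mathcal{D}$ set $\mathbf{H}=\mathbf{S}(\mathbf{S}^\top\mathbf{A}\mathbf{B}^{-1}\mathbf{A}^\top\mathbf{S})^\dagger\mathbf{S}^\top$ ($\dagger$ denotes the Moore–Penrose pseudoinverse) and $\mathbf{Z}=\mathbf{A}^\top\mathbf{H}\mathbf{A}$; $\mathbb{E}[\mathbf{Z}]$ is assumed finite. Let $\mathbf{W}=\mathbf{B}^{-1/2}\mathbb{E}[\mathbf{Z}]\mathbf{B}^{-1/2}$ (its eigenvalues lie in $[0,1]$); $\lambda_{\min}^+$ is its smallest nonzero eigenvalue. Exactness means $\mathrm{Null}(\mathbb{E}[\mathbf{Z}])=\mathrm{Null}(\mathbf{A})$. The matrices $\mathbf{S}_k$ are drawn i.i.d. from $\mathcal{D}$ ($\mathbf{S}_k$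 independent of $x^k$). *)

(* Defs.v *)
From HB Require Import structures.
From mathcomp Require Import all_boot all_order all_algebra.
From mathcomp Require Import all_classical all_reals all_analysis.
Set Implicit Arguments. Unset Strict Implicit. Unset Printing Implicit Defensive.
Import Order.TTheory GRing.Theory Num.Theory.
Local Open Scope classical_set_scope.
Local Open Scope ring_scope.

(* Moore--Penrose pseudoinverse: the (unique) X satisfying the four Penrose
   equations; (chosen classically; 0 if none existed, which never happens). *)
Definition is_mp_pinv (R : realType) (p q : nat) (M : 'M[R]_(p, q)) (X : 'M[R]_(q, p)) :=
  [/\ M *m X *m M = M, X *m M *m X = X,
      (M *m X)^T = M *m X & (X *m M)^T = X *m M].

Definition mp_pinv (R : realType) (p q : nat) (M : 'M[R]_(p, q)) : 'M[R]_(q, p) :=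
  match pselect (exists X, is_mp_pinv M X) with
  | left h => projT1 (cid h)
  | right _ => 0
  end.

Definition qform (R : realType) (p : nat) (M : 'M[R]_p) (v : 'cV[R]_p) : R :=
  (v^T *m M *m v) ord0 ord0.

Definition symmetric_mx (R : realType) (p : nat) (M : 'M[R]_p) := M^T = M.

Definition posdef_mx (R : realType) (p : nat) (M : 'M[R]_p) :=
  symmetric_mx M /\ forall v : 'cV[R]_p, v != 0 -> 0 < qform M v.

Definition spd_sqrt (R : realType) (p : nat) (B : 'M[R]_p) : 'M[R]_p :=
  match pselect (exists C : 'M[R]_p, posdef_mx C /\ C *m C = B) with
  | left h => projT1 (cid h)
  | right _ => 0
  end.

Definition lambda_min_plus (R : realType) (p : nat) (W : 'M[R]_p) : R :=
  inf [set a : R | eigenvalue W a && (a != 0)].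

Definition sketch (R : realType) (m : nat) := {q : nat & 'M[R]_(m, q)}.

Definition Msk (R : realType) (m n : nat) (A : 'M[R]_(m, n)) (B : 'M[R]_n)
  (q : nat) (Sm : 'M[R]_(m, q)) : 'M[R]_q :=
  Sm^T *m A *m invmx B *m A^T *m Sm.

Definition Zsk (R : realType) (m n : nat) (A : 'M[R]_(m, n)) (B : 'M[R]_n)
  (s : sketch R m) : 'M[R]_n :=
  let: existT q Sm := s in A^T *m (Sm *m mp_pinv (Msk A B Sm) *m Sm^T) *m A.

Definition colv (R : realType) (q : nat) (v : nat -> R) : 'cV[R]_q :=
  \col_(i < q) v i.

Definition step (R : realType) (m n : nat) (A : 'M[R]_(m, n)) (B : 'M[R]_n)
  (s : sketch R m) (lam : nat -> R) : 'cV[R]_n :=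
  let: existT q Sm := s in invmx B *m A^T *m Sm *m colv q lam.

Definition inner_err (R : realType) (m n : nat) (A : 'M[R]_(m, n)) (B : 'M[R]_n)
  (b : 'cV[R]_m) (x : 'cV[R]_n) (s : sketch R m) (lam : nat -> R) : R :=
  let: existT q Sm := s in
  let M := Msk A B Sm in
  let d := Sm^T *m (b - A *m x) in
  qform M (colv q lam - mp_pinv M *m d).

Definition inner_init (R : realType) (m n : nat) (A : 'M[R]_(m, n)) (B : 'M[R]_n)
  (b : 'cV[R]_m) (x : 'cV[R]_n) (s : sketch R m) : R :=
  let: existT q Sm := s in
  let M := Msk A B Sm in
  let d := Sm^T *m (b - A *m x) in
  qform M (0 - mp_pinv M *m d).

Definition is_B_proj (R : realType) (m n : nat) (A : 'M[R]_(m, n)) (B : 'M[R]_n)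
  (b : 'cV[R]_m) (x0 xs : 'cV[R]_n) :=
  A *m xs = b /\ forall x' : 'cV[R]_n, A *m x' = b -> qform B (xs - x0) <= qform B (x' - x0).

Definition gen_cV (d : measure_display) (T : measurableType d) (R : realType) (n : nat)
  (X : T -> 'cV[R]_n) : set (set T) :=
  [set F | exists i : 'I_n, exists2 Bs : set R, measurable Bs & F = (fun w => X w i ord0) @^-1` Bs].

Definition gen_rv (d : measure_display) (T : measurableType d)
  (dU : measure_display) (U : measurableType dU) (Y : T -> U) : set (set T) :=
  [set F | exists2 E : set U, measurable E & F = Y @^-1` E].

Definition indep_sigma (d : measure_display) (T : measurableType d) (R : realType)
  (P : probability T R) (G1 G2 : set (set T)) :=
  forall F1 F2, <<s G1 >> F1 -> <<s G2 >> F2 -> P (F1 `&` F2) = (P F1 * P F2)%E.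

Definition mutually_indep (d : measure_display) (T : measurableType d) (R : realType)
  (P : probability T R) (dU : measure_display) (U : measurableType dU) (Y : nat -> T -> U) :=
  forall (s : seq nat) (E : nat -> set U), uniq s -> (forall k, measurable (E k)) ->
    P (\bigcap_(k in [set` s]) (Y k @^-1` E k)) = (\prod_(k <- s) P (Y k @^-1` E k))%E.

Definition EZ (R : realType) (m n : nat) (A : 'M[R]_(m, n)) (B : 'M[R]_n)
  (dU : measure_display) (U : measurableType dU) (D : probability U R)
  (mat : U -> sketch R m) : 'M[R]_n :=
  \matrix_(i, j) fine (\int[D]_u ((Zsk A B (mat u)) i j)%:E).

(* Main.v *)
Require Import Defs.
From HB Require Import structures.
From mathcomp Require Import all_boot all_order all_algebra.
From mathcomp Require Import complex ring lra.
From mathcomp Require Import all_classical all_reals all_analysis.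
From mathcomp Require Import measurable_realfun.
Import Order.TTheory GRing.Theory Num.Theory.
Local Open Scope classical_set_scope.
Local Open Scope ring_scope.

(** One step of the method splits B-orthogonally. With e = x^k - x*, the exact sketch step replaces
   e by (1 - B^-1 Z) e, of squared B-norm |e|_B^2 - e^T Z e, and the inexactness adds an error in
   the range of B^-1 A^T S_k, which is B-orthogonal to (1 - B^-1 Z) e and has squared norm
   |lambda_r - lambda_*|_M^2; moreover |lambda_0 - lambda_*|_M^2 = e^T Z e. Hence
   E|e'|_B^2 <= E|e|_B^2 - (1 - theta^r) E[e^T Z e], and by independence E[e^T Z e] =
   E[e^T E[Z] e]. As B e stays in the range of A^T, exactness makes B^(1/2) e orthogonal to
   Null(W), so e^T E[Z] e >= lambda_min^+ |e|_B^2. *)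

Set Implicit Arguments. Unset Strict Implicit. Unset Printing Implicit Defensive.

(** * Polynomial functional calculus of a real symmetric matrix *)

Lemma poly_interpolation (F : fieldType) (f : F -> F) (s : seq F) :
  uniq s -> exists p : {poly F}, forall a, a \in s -> p.[a] = f a.
Proof.
elim: s => [|c s IH] /=; first by exists 0.
case/andP=> cs /IH[p hp].
(* Newton's correction: [q] vanishes at the old nodes and not at [c]. *)
pose q := \prod_(a <- s) ('X - a%:P).
have qc : q.[c] != 0.
  rewrite -/(root q c) root_prod_XsubC //.
exists (p + ((f c - p.[c]) / q.[c]) *: q) => a.
rewrite inE hornerD hornerZ; case: eqP => [-> _|_ /= as_].
  by rewrite mulfVK // addrC subrK.
have /rootP -> : root q a by rewrite root_prod_XsubC.
by rewrite mulr0 addr0 hp.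
Qed.

(** Over [R[i]] the matrix becomes Hermitian, hence unitarily diagonalisable with real diagonal
    entries, and the product kills each of them. Repetitions are removed because divisibility by the
    product is later deduced from its roots. *)
Lemma sym_annihilating_poly (R : rcfType) n (W : 'M[R]_n.+1) : W^T = W ->
  exists s : seq R, [/\ uniq s, all (eigenvalue W) s
    & horner_mx W (\prod_(a <- s) ('X - a%:P)) = 0].
Proof.
move=> Wsym; pose C := (R[i])%type; pose phi := real_complex R.
pose Wc := map_mx phi W.
have Wc_real : Wc \is a mxOver Num.real.
  by apply/mxOverP => i j; rewrite mxE complex_real.
have Wc_sym : Wc \is symmetricmx.
  apply/is_hermitianmxP; rewrite expr0 scale1r.
  by apply/matrixP => i j; rewrite !mxE -[in LHS]Wsym mxE.
have Wc_herm := realsym_hermsym Wc_sym Wc_real.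
have /hermitian_normalmx/orthomx_spectralP := Wc_herm.
have := hermitian_spectral_diag_real Wc_herm.
have := spectral_unit Wc.
set Q := spectralmx Wc; set D := spectral_diag Wc => Qu Dreal WcE.
have DE j : D 0 j = phi (complex.Re (D 0 j)).
  have /mxOverP/(_ 0 j) := Dreal.
  by move/RRe_real => <-.
pose s := undup [seq complex.Re (D 0 j) | j : 'I_n.+1].
exists s; split; first exact: undup_uniq.
- apply/allP => a; rewrite mem_undup => /mapP[j _ ->].
  rewrite eigenvalue_root_char -(fmorph_root phi) map_char_poly -/Wc.
  rewrite -[X in root _ X]/(phi _) -DE -eigenvalue_root_char; apply/eigenvalueP.
  exists (row j Q).
    rewrite {1}WcE !mulmxA -row_mul mulmxV // row1 -rowE row_diag_mx.
    by rewrite -scalemxAl -rowE.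
  apply/negP => /eqP Q0; have : row j (Q *m invmx Q) = 0 by rewrite row_mul Q0 mul0mx.
  by rewrite mulmxV // row1 => /rowP/(_ j); rewrite !mxE !eqxx => /eqP; rewrite oner_eq0.
- apply: (map_mx_inj (f := phi)); rewrite map_mx0 map_horner_mx -/Wc WcE.
  rewrite mxpoly.horner_mx_uconjC // horner_mx_diag.
  set E := map_mx _ D; suff -> : E = 0 by rewrite raddf0 mulmx0 mul0mx.
  apply/rowP => j; rewrite !mxE DE.
  apply/rootP; rewrite (fmorph_root phi) root_prod_XsubC mem_undup.
  by apply: map_f; rewrite mem_enum.
Qed.

Lemma trmx_horner (R : comNzRingType) n (W : 'M[R]_n.+1) (p : {poly R}) :
  (horner_mx W p)^T = horner_mx W^T p.
Proof.
elim/poly_ind: p => [|p c IH]; first by rewrite !rmorph0 ?trmx0.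
rewrite [in LHS]mulrC !rmorphD !rmorphM /= !horner_mx_X !horner_mx_C.
by rewrite linearD /= -mulmxE trmx_mul IH tr_scalar_mx.
Qed.

(* F f is p(W) for a polynomial p interpolating f on the spectrum of W; this determines
   F f because the minimal polynomial of W has simple real roots. *)
Lemma sym_functional_calculus (R : rcfType) n (W : 'M[R]_n) : W^T = W ->
  exists F : (R -> R) -> 'M[R]_n,
  [/\ (forall f, (F f)^T = F f)
    , (forall f g, F (fun a => f a * g a) = F f *m F g)
    , (forall f g, F (fun a => f a - g a) = F f - F g)
    , (forall c, F (fun=> c) = c%:M) /\ F id = W
    & (forall f g, (forall a, eigenvalue W a -> f a = g a) -> F f = F g)].
Proof.
case: n W => [|n] W Wsym.
  have mx0 (X Y : 'M[R]_0) : X = Y by rewrite [X]flatmx0 [Y]flatmx0.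
  by exists (fun=> 0); split=> *; try split=> *; apply: mx0.
have [s [us sW hs]] := sym_annihilating_poly Wsym.
have key p q : (forall a, a \in s -> p.[a] = q.[a]) -> horner_mx W p = horner_mx W q.
  move=> pq; apply/eqP; rewrite -subr_eq0 -rmorphB.
  have : \prod_(a <- s) ('X - a%:P) %| p - q.
    apply: uniq_roots_dvdp; last by rewrite uniq_rootsE.
    by apply/allP => a /pq e; rewrite rootE hornerD hornerN e subrr.
  by case/dvdpP => r ->; rewrite rmorphM /= hs mulr0.
pose p f := projT1 (cid (poly_interpolation f us)).
have pE f a : a \in s -> (p f).[a] = f a by exact: (projT2 (cid (poly_interpolation f us))).
exists (fun f => horner_mx W (p f)); split.
- by move=> f; rewrite trmx_horner Wsym.
- move=> f g; rewrite mulmxE -rmorphM; apply: key => a as_.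
  by rewrite hornerM !pE.
- move=> f g; rewrite -rmorphB; apply: key => a as_.
  by rewrite hornerD hornerN !pE.
- split=> [c|].
    by rewrite -(horner_mx_C W); apply: key => a as_; rewrite hornerC pE.
  by rewrite -[RHS](horner_mx_X W); apply: key => a as_; rewrite hornerX pE.
- move=> f g fg; apply: key => a as_; rewrite !pE //.
  by apply: fg; move/allP: sW; apply.
Qed.

(** * Quadratic forms, pseudoinverses, square roots and the smallest nonzero eigenvalue *)

Section QuadraticForms.
Variable R : realType.

Lemma qform1E p (v : 'cV[R]_p) : qform 1%:M v = \sum_i v i 0 ^+ 2.
Proof.
rewrite /qform mulmx1 mxE; apply: eq_bigr => i _.
by rewrite mxE expr2.
Qed.

Lemma qform1_ge0 p (v : 'cV[R]_p) : 0 <= qform 1%:M v.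
Proof. by rewrite qform1E sumr_ge0 // => i _; rewrite sqr_ge0. Qed.

Lemma qform1_eq0 p (v : 'cV[R]_p) : (qform 1%:M v == 0) = (v == 0).
Proof.
rewrite qform1E psumr_eq0; last by move=> i _; rewrite sqr_ge0.
apply/allP/eqP => [h|-> i _]; last by rewrite mxE expr2 mul0r eqxx.
apply/colP => i; have := h i (mem_index_enum _).
by rewrite /= sqrf_eq0 mxE => /eqP.
Qed.

Lemma qform_congr p q (M : 'M[R]_p) (N : 'M[R]_(p, q)) (v : 'cV[R]_q) :
  qform M (N *m v) = qform (N^T *m M *m N) v.
Proof. by rewrite /qform trmx_mul !mulmxA. Qed.

Lemma qform_gram p q (N : 'M[R]_(p, q)) (v : 'cV[R]_q) :
  qform (N^T *m N) v = qform 1%:M (N *m v).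
Proof. by rewrite qform_congr mulmx1. Qed.

Lemma qformN p (M : 'M[R]_p) (v : 'cV[R]_p) : qform M (- v) = qform M v.
Proof. 
rewrite /qform; have -> : (- v)^T = - v^T by rewrite linearN.
by rewrite mulmxN !mulNmx opprK.
 Qed.

Lemma qformDr p (M : 'M[R]_p) (u v : 'cV[R]_p) : M^T = M ->
  qform M (u + v) = qform M u + 2 * (u^T *m M *m v) 0 0 + qform M v.
Proof.
move=> Ms; have vu : (v^T *m M *m u) 0 0 = (u^T *m M *m v) 0 0.
  transitivity ((v^T *m M *m u)^T 0 0); first by rewrite [RHS]mxE.
  by rewrite !trmx_mul trmxK Ms mulmxA.
rewrite /qform; have -> : (u + v)^T = u^T + v^T by rewrite linearD.
rewrite !mulmxDl !mulmxDr.
have mxD (X Y : 'M[R]_1) : (X + Y) 0 0 = X 0 0 + Y 0 0 by rewrite mxE.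
by rewrite !mxD vu; ring.
Qed.

Lemma posdef_ge0 p (M : 'M[R]_p) v : posdef_mx M -> 0 <= qform M v.
Proof.
move=> [_ pos]; have [->|/pos/ltW //] := eqVneq v 0.
by rewrite /qform mulmx0 mxE.
Qed.

Lemma posdef_eq0 p (M : 'M[R]_p) v : posdef_mx M -> qform M v = 0 -> v = 0.
Proof.
move=> [_ pos] q0; apply/eqP; apply: contraT => /pos.
by rewrite q0 ltxx.
Qed.

Lemma posdef_unitmx p (M : 'M[R]_p) : posdef_mx M -> M \in unitmx.
Proof.
move=> Mpos; rewrite -row_free_unit -kermx_eq0; apply/eqP/row_matrixP => i.
rewrite row0; apply: trmx_inj; rewrite trmx0; apply: (posdef_eq0 Mpos).
by rewrite /qform trmxK -row_mul mulmx_ker row0 mul0mx mxE.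
Qed.

Lemma posdef_invmx p (M : 'M[R]_p) : posdef_mx M -> posdef_mx (invmx M).
Proof.
move=> Mpos; have Mu := posdef_unitmx Mpos; have [Ms pos] := Mpos.
have Is : (invmx M)^T = invmx M by rewrite trmx_inv Ms.
split=> // v v0; have -> : invmx M = (invmx M)^T *m M *m invmx M.
  by rewrite Is mulVmx // mul1mx.
rewrite -qform_congr; apply: pos; apply: contra_neq v0 => e.
by rewrite -[v](mulKVmx Mu) e mulmx0.
Qed.

Lemma gram_posdef_eq0 p q (M : 'M[R]_p) (N : 'M[R]_(q, p)) : posdef_mx M ->
  N *m M *m N^T = 0 -> N = 0.
Proof.
move=> Mpos h; apply/row_matrixP => i; rewrite row0.
apply: trmx_inj; rewrite trmx0; apply: (posdef_eq0 Mpos).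
have -> : (row i N)^T = N^T *m delta_mx i 0 by rewrite rowE trmx_mul trmx_delta.
by rewrite qform_congr trmxK h /qform mulmx0 mul0mx mxE.
Qed.

Lemma eigenvalue_qform p (M : 'M[R]_p) a : eigenvalue M a ->
  exists2 v, v != 0 & qform M v = a * qform 1%:M v.
Proof.
move=> /eigenvalueP[v vM v0]; exists v^T; first by rewrite -(inj_eq trmx_inj) trmxK trmx0.
by rewrite /qform trmxK vM mulmx1 -scalemxAl mxE.
Qed.

(** [M Y M X] collapses to [M X] and its transpose [M X M Y] to [M Y]; as [M X] is symmetric, the
    two agree. Likewise [X M = Y M], and then [X = X M X = Y M Y = Y]. *)
Lemma mp_pinv_uniq p q (M : 'M[R]_(p, q)) X Y :
  is_mp_pinv M X -> is_mp_pinv M Y -> X = Y.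
Proof.
move=> [X1 X2 X3 X4] [Y1 Y2 Y3 Y4].
have e1 : M *m X = M *m Y.
  have := congr1 trmx (mulmxA (M *m Y) M X).
  by rewrite Y1 trmx_mul Y3 X3 mulmxA X1.
have e2 : X *m M = Y *m M.
  have := congr1 trmx (mulmxA X M (Y *m M)).
  by rewrite (mulmxA M Y M) Y1 X4 trmx_mul X4 Y4 -mulmxA (mulmxA M X M) X1.
by rewrite -X2 e2 -mulmxA e1 mulmxA Y2.
Qed.

(** The witness is inversion under the functional calculus; the convention [0^-1 = 0] is what the
    Penrose equations ask on the kernel. Symmetry passes to [mp_pinv] by uniqueness. *)
Lemma sym_mp_pinvP p (M : 'M[R]_p) : M^T = M ->
  is_mp_pinv M (mp_pinv M) /\ (mp_pinv M)^T = mp_pinv M.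
Proof.
move=> Ms; have [F [Fs FM FB [Fc Fi] Fe]] := sym_functional_calculus Ms.
have XP : is_mp_pinv M (F (fun a => a^-1)).
  have E f g h : (forall a, f a * g a * h a = f a) -> F f *m F g *m F h = F f.
    by move=> e; rewrite -!FM; apply: Fe.
  rewrite -[X in is_mp_pinv X _]Fi; split; rewrite ?E -?FM ?Fs //.
  - by move=> a /=; have [->|a0] := eqVneq a 0; [rewrite !mul0r|rewrite mulfV ?mul1r].
  - by move=> a /=; have [->|a0] := eqVneq a 0; [rewrite invr0 !mul0r|rewrite mulVf ?mul1r].
have PP : is_mp_pinv M (mp_pinv M).
  rewrite /mp_pinv; case: pselect => [h|[]]; last by eexists; exact: XP.
  exact: projT2 (cid h).
by split=> //; rewrite (mp_pinv_uniq PP XP) Fs.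
Qed.

(** The witness applies [Num.sqrt] to the nonnegative spectrum. Its form at [v] is the squared norm
    of [G v], with [G] the fourth root of [B], and [G v = 0] would make the form of [B] vanish at
    [v]. *)
Lemma spd_sqrtP p (B : 'M[R]_p) : posdef_mx B ->
  posdef_mx (spd_sqrt B) /\ spd_sqrt B *m spd_sqrt B = B.
Proof.
move=> Bpos; have [Bs _] := Bpos.
rewrite /spd_sqrt; case: pselect => [h|[]]; first exact: projT2 (cid h).
have [F [Fs FM FB [Fc Fi] Fe]] := sym_functional_calculus Bs.
have eig_ge0 a : eigenvalue B a -> 0 <= a.
  move=> /eigenvalue_qform[v v0 e]; have := posdef_ge0 v Bpos.
  rewrite e pmulr_lge0 // lt_neqAle qform1_ge0 andbT eq_sym qform1_eq0 //.
have sq f : (forall a, 0 <= f a) -> F f = (F (Num.sqrt \o f))^T *m F (Num.sqrt \o f).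
  by move=> f0; rewrite Fs -FM; apply: Fe => a _ /=; rewrite -expr2 sqr_sqrtr.
have CC : F Num.sqrt *m F Num.sqrt = B.
  by rewrite -FM -[RHS]Fi; apply: Fe => a /eig_ge0 a0; rewrite -expr2 sqr_sqrtr.
exists (F Num.sqrt); split=> //; split=> [|v v0]; first exact: Fs.
rewrite sq; last by move=> a; rewrite sqrtr_ge0.
rewrite qform_gram lt_neqAle qform1_ge0 andbT eq_sym qform1_eq0.
apply: contra_neq v0 => Gv; apply: (posdef_eq0 Bpos).
rewrite -CC sq; last by move=> a; rewrite sqrtr_ge0.
by rewrite /qform -!mulmxA Gv !mulmx0 mxE.
Qed.

(* W - lambda P, with P the orthogonal projector onto the range of W, is the image of
   a - lambda [a <> 0] under the functional calculus; this is nonnegative on the spectrum. *)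
Lemma lambda_min_plus_qform p (W : 'M[R]_p) (v : 'cV[R]_p) :
  W^T = W -> (forall u, 0 <= qform W u) ->
  (forall u : 'cV[R]_p, W *m u = 0 -> v^T *m u = 0) ->
  lambda_min_plus W * qform 1%:M v <= qform W v.
Proof.
move=> Ws Wpsd vker; set l := lambda_min_plus W.
have [F [Fs FM FB [Fc Fi] Fe]] := sym_functional_calculus Ws.
have eig_ge0 a : eigenvalue W a -> 0 <= a.
  move=> /eigenvalue_qform[u u0 e]; have := Wpsd u.
  by rewrite e pmulr_lge0 // lt_neqAle qform1_ge0 andbT eq_sym qform1_eq0.
have l_le a : eigenvalue W a -> a != 0 -> l <= a.
  move=> Wa a0; apply: ge_inf; last by rewrite /= Wa.
  by exists 0 => b /= /andP[/eig_ge0].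
pose ind (a : R) : R := (a != 0)%:R.
pose P := F ind.
have PP : P *m P = P.
  by rewrite -FM; apply: Fe => a _; rewrite /ind; case: (a == 0); rewrite ?mulr1 ?mulr0.
have WP : W *m P = W.
  rewrite -[W in LHS]Fi -FM -[RHS]Fi; apply: Fe => a _ /=.
  by rewrite /ind; case: eqP => [->|_]; rewrite ?mulr1 ?mul0r.
(* The squared norm of [v - P v] is [v^T (1 - P) v], which vanishes because [(1 - P) v] lies in the
   null space of [W]. *)
have Pv : P *m v = v.
  apply/eqP; rewrite eq_sym -subr_eq0 -qform1_eq0.
  have -> : v - P *m v = (1%:M - P) *m v by rewrite mulmxBl mul1mx.
  have sI : (1%:M - P)^T = 1%:M - P by rewrite linearB /= trmx1 Fs.
  rewrite -qform_gram sI mulmxBl mul1mx mulmxBr mulmx1 PP subrr subr0.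
  rewrite /qform -mulmxA vker ?mxE //.
  by rewrite mulmxA mulmxBr mulmx1 WP subrr mul0mx.
pose g a := Num.sqrt (a - l * ind a).
have key : (F g)^T *m F g = W - l%:M *m P.
  rewrite Fs -FM -[W in RHS]Fi -Fc -FM -FB; apply: Fe => a Wa /=.
  rewrite /g -expr2 sqr_sqrtr // /ind; have [->|a0] := eqVneq a 0.
    by rewrite mulr0 subr0.
  by rewrite mulr1 subr_ge0 l_le.
have := qform1_ge0 (F g *m v).
rewrite -qform_gram key.
have mxB (X Y : 'M[R]_1) c : (X - c *: Y) 0 0 = X 0 0 - c * Y 0 0 by rewrite !mxE.
have -> : qform (W - l%:M *m P) v = qform W v - l * qform 1%:M v.
  by rewrite /qform mulmx1 mulmxBr mulmxBl -!mulmxA Pv mul_scalar_mx -scalemxAr mxB.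
by rewrite subr_ge0.
Qed.
End QuadraticForms.

(** * Algebra of a single sketch step *)

Section Sketch.
Variables (R : realType) (m n : nat) (A : 'M[R]_(m, n)) (B : 'M[R]_n).
Hypothesis Bpos : posdef_mx B.

Let Bs : B^T = B. Proof. by case: Bpos. Qed.
Let Bu : B \in unitmx. Proof. exact: posdef_unitmx. Qed.
Let BVs : (invmx B)^T = invmx B. Proof. by rewrite trmx_inv Bs. Qed.

Section OneSketch.
(** [N] stands for [S^T A]; fixing [q] keeps the dependent size of a sketch out of the algebra. *)
Variables (q : nat) (N : 'M[R]_(q, n)) (M X : 'M[R]_q) (Z : 'M[R]_n).
Hypothesis ME : M = N *m invmx B *m N^T.
Hypothesis XE : X = mp_pinv M.
Hypothesis ZE : Z = N^T *m X *m N.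

Let Ms : M^T = M.
Proof. by rewrite ME !trmx_mul trmxK BVs mulmxA. Qed.

Let XP : is_mp_pinv M X. Proof. by rewrite XE; case: (sym_mp_pinvP Ms). Qed.
Let Xs : X^T = X. Proof. by rewrite XE; case: (sym_mp_pinvP Ms). Qed.

(* The Gram matrix of the rows of (1 - M X) N in the metric B^-1 is (1 - M X) M (1 - M X)^T = 0. *)
Lemma Msk_pinv_id : M *m X *m N = N.
Proof.
have [X1 _ _ _] := XP.
suff : (1%:M - M *m X) *m N = 0.
  by rewrite mulmxBl mul1mx => /eqP; rewrite subr_eq0 => /eqP.
apply: (gram_posdef_eq0 (posdef_invmx Bpos)).
have KM (K : 'M[R]_q) : K *m N *m invmx B *m N^T = K *m M by rewrite ME !mulmxA.
rewrite trmx_mul mulmxA KM.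
by rewrite (mulmxBl _ _ M) mul1mx X1 subrr mul0mx.
Qed.

Lemma trmx_Zsk1 : Z^T = Z.
Proof. by rewrite ZE !trmx_mul trmxK Xs mulmxA. Qed.

(** Together with the symmetry of [Z], this makes [B^-1 Z] a B-orthogonal projector. It comes from
    [X M X = X]. *)
Lemma Zsk1_proj : Z *m invmx B *m Z = Z.
Proof.
have [_ X2 _ _] := XP.
transitivity (N^T *m (X *m M *m X) *m N); last by rewrite X2 ZE.
by rewrite ZE [in RHS]ME !mulmxA.
Qed.

Lemma qform_Zsk1_residual e :
  qform B (e - invmx B *m Z *m e) = qform B e - qform Z e.
Proof.
rewrite qformDr // qformN qform_congr.
have -> : (invmx B *m Z)^T *m B *m (invmx B *m Z) = Z.
  by rewrite trmx_mul BVs trmx_Zsk1 !mulmxA mulmxKV // Zsk1_proj.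
have -> : (e^T *m B *m - (invmx B *m Z *m e)) 0 0 = - qform Z e.
  by rewrite mulmxN !mulmxA mulmxK // mxE.
by ring.
Qed.

Lemma qform_pinv1 e : qform M (X *m N *m e) = qform Z e.
Proof.
have [_ X2 _ _] := XP.
rewrite qform_congr (_ : _ *m _ = N^T *m (X *m M *m X) *m N); first by rewrite X2 ZE.
by rewrite trmx_mul Xs !mulmxA.
Qed.

(** [- X N e] is the exact inner solution, so [mu] is the inner error. The cross term vanishes
    because [Z B^-1 N^T = N^T], the transpose of [M X N = N]. Keeping the [Z] term on the left
    leaves only sums of nonnegative terms, which can be integrated before finiteness is known. *)
Lemma step1_error e l :
  qform B (e + invmx B *m N^T *m l) + qform Z e = qform B e + qform M (l + X *m N *m e).
Proof.
set mu := l + _.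
have -> : e + invmx B *m N^T *m l = (e - invmx B *m Z *m e) + invmx B *m N^T *m mu.
  by rewrite mulmxDr ZE !mulmxA [_ *m l + _]addrC addrA subrK.
rewrite qformDr // qform_Zsk1_residual.
have -> : (e - invmx B *m Z *m e)^T *m B *m (invmx B *m N^T *m mu) = 0.
  have -> : e - invmx B *m Z *m e = (1%:M - invmx B *m Z) *m e.
    by rewrite mulmxBl mul1mx.
  rewrite trmx_mul !mulmxA mulmxK // linearB /= trmx1 trmx_mul BVs trmx_Zsk1.
  rewrite -(mulmxA e^T) mulmxBl mul1mx -(mulmxA Z).
  have -> : Z *m (invmx B *m N^T) = N^T.
    transitivity ((M *m X *m N)^T); last by rewrite Msk_pinv_id.
    by rewrite !trmx_mul Ms Xs ZE ME !mulmxA.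
  by rewrite subrr mulmx0 mul0mx.
have -> : qform B (invmx B *m N^T *m mu) = qform M mu.
  by rewrite qform_congr trmx_mul trmxK BVs !mulmxA mulmxKV // ME.
by rewrite mxE; ring.
Qed.
End OneSketch.

Let trNE q (S : 'M[R]_(m, q)) : (S^T *m A)^T = A^T *m S.
Proof. by rewrite trmx_mul trmxK. Qed.

Let MskE q (S : 'M[R]_(m, q)) : Msk A B S = (S^T *m A) *m invmx B *m (S^T *m A)^T.
Proof. by rewrite trNE /Msk !mulmxA. Qed.

Let ZskE q (S : 'M[R]_(m, q)) :
  Zsk A B (existT _ q S) = (S^T *m A)^T *m mp_pinv (Msk A B S) *m (S^T *m A).
Proof. by rewrite trNE /Zsk !mulmxA. Qed.

Lemma trmx_Zsk s : (Zsk A B s)^T = Zsk A B s.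
Proof. by case: s => q S; exact: (trmx_Zsk1 (MskE S) erefl (ZskE S)). Qed.

Lemma qform_Zsk_ge0 s v : 0 <= qform (Zsk A B s) v.
Proof.
rewrite (_ : qform _ v = qform (invmx B) (Zsk A B s *m v)).
  exact/posdef_ge0/posdef_invmx.
by rewrite qform_congr trmx_Zsk; case: s => q S; rewrite (Zsk1_proj (MskE S) erefl (ZskE S)).
Qed.

Lemma qform_Zsk_le s v : qform (Zsk A B s) v <= qform B v.
Proof.
case: s => q S; rewrite -subr_ge0 -(qform_Zsk1_residual (MskE S) erefl (ZskE S)).
exact: posdef_ge0.
Qed.

Lemma inner_initE (b : 'cV[R]_m) x xs s : A *m xs = b ->
  inner_init A B b x s = qform (Zsk A B s) (x - xs).
Proof.
move=> <-; case: s => q S; rewrite /inner_init -mulmxBr (mulmxA S^T) sub0r.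
have -> (Y : 'M[R]_q) (K : 'M[R]_(q, n)) : - (Y *m (K *m (xs - x))) = Y *m K *m (x - xs).
  by rewrite -!mulmxN opprB mulmxA.
exact: (qform_pinv1 (MskE S) erefl (ZskE S)).
Qed.

Lemma step_error (b : 'cV[R]_m) x xs s lam : A *m xs = b ->
  qform B (x + step A B s lam - xs) + qform (Zsk A B s) (x - xs) =
  qform B (x - xs) + inner_err A B b x s lam.
Proof.
move=> <-; case: s => q S; rewrite /step /inner_err -mulmxBr (mulmxA S^T).
have -> (Y : 'M[R]_q) (K : 'M[R]_(q, n)) : - (Y *m (K *m (xs - x))) = Y *m K *m (x - xs).
  by rewrite -!mulmxN opprB mulmxA.
rewrite addrAC -(mulmxA _ A^T S) -trNE.
exact: (step1_error (MskE S) erefl (ZskE S)).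
Qed.

Lemma inner_err_ge0 (b : 'cV[R]_m) x s lam : 0 <= inner_err A B b x s lam.
Proof.
case: s => q S; rewrite /inner_err /=; set l := (X in qform _ X).
rewrite /Msk; have -> : S^T *m A *m invmx B *m A^T *m S = (A^T *m S)^T *m invmx B *m (A^T *m S).
  by rewrite trmx_mul trmxK !mulmxA.
by rewrite -qform_congr; apply: posdef_ge0 (posdef_invmx Bpos).
Qed.

(** Keeps [B e] in the range of [A^T] along the iteration, as the eigenvalue bound requires. *)
Lemma step_range s lam : exists y : 'cV[R]_m, B *m step A B s lam = A^T *m y.
Proof.
case: s => q S; exists (S *m colv q lam).
by rewrite /step !mulmxA mulmxV // mul1mx.
Qed.

(* Optimality of the projection makes B (x0 - xs) orthogonal to Null A, hence a combination
   of the rows of A. *)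
Lemma is_B_proj_range (b : 'cV[R]_m) x0 xs : is_B_proj A B b x0 xs ->
  exists y : 'cV[R]_m, B *m (x0 - xs) = A^T *m y.
Proof.
move=> [Axs opt]; pose g := B *m (x0 - xs).
have orth (z : 'cV[R]_n) : A *m z = 0 -> (z^T *m g) 0 0 = 0.
  move=> Az; pose c := (z^T *m g) 0 0.
  have qz0 := posdef_ge0 z Bpos.
  have ineq (t : R) : 0 <= t ^+ 2 * qform B z - 2 * t * c.
    have := opt (xs + t *: z); rewrite mulmxDr -scalemxAr Az scaler0 addr0 => /(_ Axs).
    rewrite addrAC [xs - x0 + _]addrC (qformDr (t *: z) _ Bs).
    have mxZ (k : R) (K : 'M[R]_1) : (k *: K) 0 0 = k * K 0 0 by rewrite mxE.
    have mxN (K : 'M[R]_1) : (- K) 0 0 = - K 0 0 by rewrite mxE.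
    have zT : (t *: z)^T = t *: z^T by rewrite linearZ.
    have -> : qform B (t *: z) = t ^+ 2 * qform B z.
      by rewrite /qform zT -scalemxAr -!scalemxAl !mxZ mulrA.
    have -> : ((t *: z)^T *m B *m (xs - x0)) 0 0 = - (t * c).
      by rewrite zT -!scalemxAl mxZ -opprB mulmxN -mulmxA mxN mulrN.
    by rewrite -subr_ge0; congr (0 <= _); ring.
  have w0 : 0 < (1 + qform B z)^-1 by rewrite invr_gt0 ltr_pwDl.
  (* The minimiser would be [t = c / qform B z]; the added 1 keeps the denominator positive when
     [z = 0], and the right side becomes [- c^2 w (1 + w)], which forces [c = 0]. *)
  have := ineq (c * (1 + qform B z)^-1); set w := _^-1 in w0 *.
  have e : qform B z * w = 1 - w.
    have wE : w * (1 + qform B z) = 1 by rewrite mulVf // gt_eqF // ltr_pwDl.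
    by apply: (addIr w); rewrite subrK -wE; ring.
  have -> : (c * w) ^+ 2 * qform B z - 2 * (c * w) * c = - (c ^+ 2 * (w * (1 + w))).
    by rewrite [LHS](_ : _ = c ^+ 2 * w * (qform B z * w) - 2 * c ^+ 2 * w); [rewrite e; ring|ring].
  have ww : 0 < w * (1 + w) by rewrite mulr_gt0 // addr_gt0.
  rewrite oppr_ge0 pmulr_lle0 // => c2.
  by apply/eqP; rewrite -sqrf_eq0 eq_le c2 sqr_ge0.
have : (g^T <= A)%MS.
  rewrite submxE; apply/eqP/rowP => j; rewrite [RHS]mxE.
  have -> : (g^T *m cokermx A) 0 j = ((col j (cokermx A))^T *m g) 0 0.
    transitivity ((g^T *m col j (cokermx A)) 0 0).
      by rewrite [LHS]mxE [RHS]mxE; apply: eq_bigr => k _; rewrite [col _ _ _ _]mxE.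
    transitivity ((g^T *m col j (cokermx A))^T 0 0); first by rewrite [RHS]mxE.
    by rewrite trmx_mul trmxK.
  by apply: orth; rewrite colE (mulmxA A) mulmx_coker mul0mx.
by case/submxP => y /(congr1 trmx); rewrite trmxK trmx_mul => e; exists y^T.
Qed.
End Sketch.

(** * The expected sketch matrix and its spectral bounds *)

Lemma qform_sum (R : realType) p (M : 'M[R]_p) (v : 'cV[R]_p) :
  qform M v = \sum_i \sum_j (v i 0 * v j 0) * M i j.
Proof.
rewrite /qform mxE exchange_big; apply: eq_bigr => j _ /=.
rewrite mxE mulr_suml; apply: eq_bigr => i _.
by rewrite mxE; ring.
Qed.

Section ExpectedSketch.
Variables (R : realType) (m n : nat) (A : 'M[R]_(m, n)) (B : 'M[R]_n).
Variables (dU : measure_display) (U : measurableType dU) (D : probability U R).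
Variable mat : U -> sketch R m.
Hypothesis Bpos : posdef_mx B.
Hypothesis Zint : forall i j,
  D.-integrable setT (fun u => ((Zsk A B (mat u)) i j)%:E).
Hypothesis exactZ : forall v : 'cV[R]_n, (EZ A B D mat *m v == 0) = (A *m v == 0).

Local Notation Z u := (Zsk A B (mat u)).
Local Notation EZ' := (EZ A B D mat).
Let W := invmx (spd_sqrt B) *m EZ' *m invmx (spd_sqrt B).

Lemma trmx_EZ : EZ'^T = EZ'.
Proof.
apply/matrixP => i j; rewrite !mxE; congr fine; apply: eq_integral => u _.
by rewrite -[in RHS](trmx_Zsk A Bpos) mxE.
Qed.

Lemma integral_qform_Zsk v : (\int[D]_u (qform (Z u) v)%:E = (qform EZ' v)%:E)%E.
Proof.
have intg i j : D.-integrable setT (fun u => ((v i 0 * v j 0)%:E * (Z u i j)%:E)%E).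
  exact: integrableZl.
under eq_integral => u _.
  rewrite qform_sum -sumEFin.
  under eq_bigr => i _ do (rewrite -sumEFin; under eq_bigr => j _ do rewrite EFinM).
  over.
rewrite integral_sum //=; last by move=> i; apply: integrable_sum => // j _; exact: intg.
rewrite qform_sum -sumEFin; apply: eq_bigr => i _.
rewrite integral_sum //= -sumEFin; apply: eq_bigr => j _.
rewrite integralZl // [RHS]EFinM; congr (_ * _)%E.
by rewrite mxE fineK // integrable_fin_num.
Qed.

Lemma measurable_qform_Zsk v : measurable_fun setT (fun u => qform (Z u) v).
Proof.
under eq_fun do rewrite qform_sum.
apply: measurable_sum => i; apply: measurable_sum => j.
apply: measurable_funM => //.
by have /measurable_int/measurable_EFinP := Zint i j.
Qed.

Lemma qform_EZ_ge0 v : 0 <= qform EZ' v.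
Proof.
rewrite -lee_fin -integral_qform_Zsk; apply: integral_ge0 => u _.
by rewrite lee_fin qform_Zsk_ge0.
Qed.

Lemma qform_EZ_le v : qform EZ' v <= qform B v.
Proof.
rewrite -lee_fin -integral_qform_Zsk.
have <- : (\int[D]_u (qform B v)%:E = (qform B v)%:E)%E.
  by rewrite integral_cst //= [X in (_ * X)%E]probability_setT mule1.
apply: ge0_le_integral => //.
- by move=> u _; rewrite lee_fin qform_Zsk_ge0.
- exact/measurable_EFinP/measurable_qform_Zsk.
- by move=> u _; rewrite lee_fin qform_Zsk_le.
Qed.

Let Cpos : posdef_mx (spd_sqrt B). Proof. exact: (spd_sqrtP Bpos).1. Qed.
Let Cu : spd_sqrt B \in unitmx. Proof. exact: posdef_unitmx. Qed.
Let Cs : (spd_sqrt B)^T = spd_sqrt B. Proof. by case: Cpos. Qed.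
Let CVs : (invmx (spd_sqrt B))^T = invmx (spd_sqrt B).
Proof. by rewrite trmx_inv Cs. Qed.

Let qform_W v : qform W v = qform EZ' (invmx (spd_sqrt B) *m v).
Proof. by rewrite qform_congr CVs. Qed.

Lemma lambda_min_plus_ge0 : 0 <= lambda_min_plus W.
Proof.
rewrite /lambda_min_plus; set E := [set a | _].
(* Without nonzero eigenvalues the infimum is that of the empty set, which is 0 by convention. *)
have [->|/set0P E0] := eqVneq E set0; first by rewrite inf0.
apply: lb_le_inf => // a /= /andP[/eigenvalue_qform[v v0 e] _].
have : 0 <= qform W v by rewrite qform_W qform_EZ_ge0.
by rewrite e pmulr_lge0 // lt_neqAle qform1_ge0 andbT eq_sym qform1_eq0.
Qed.

(** This is the bound for [W] at [B^(1/2) e]. Its orthogonality condition holds: if [W u = 0], then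
    [w = B^(-1/2) u] lies in Null(E[Z]) = Null(A), and the inner product is
    [e^T B w = y^T A w = 0]. *)
Lemma lambda_min_plus_EZ (e : 'cV[R]_n) (y : 'cV[R]_m) : B *m e = A^T *m y ->
  lambda_min_plus W * qform B e <= qform EZ' e.
Proof.
move=> Be; have CC := (spd_sqrtP Bpos).2.
have -> : qform B e = qform 1%:M (spd_sqrt B *m e).
  by rewrite -qform_gram Cs CC.
have -> : qform EZ' e = qform W (spd_sqrt B *m e).
  by rewrite qform_W mulKmx.
apply: lambda_min_plus_qform.
- by rewrite /W !trmx_mul CVs trmx_EZ mulmxA.
- by move=> u; rewrite qform_W qform_EZ_ge0.
move=> u Wu; set w := invmx (spd_sqrt B) *m u.
have Aw : A *m w = 0.
  apply/eqP; rewrite -exactZ -[_ *m _](mulKVmx Cu).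
  by move: Wu; rewrite /W -!mulmxA -/w => ->; rewrite mulmx0.
have uE : u = spd_sqrt B *m w by rewrite mulKVmx.
rewrite uE trmx_mul Cs -mulmxA (mulmxA (spd_sqrt B)) CC mulmxA.
have -> : e^T *m B = y^T *m A.
  by have [Bs _] := Bpos; have := congr1 trmx Be; rewrite !trmx_mul trmxK Bs.
by rewrite -mulmxA Aw mulmx0.
Qed.

(** As [A != 0], some [e = B^-1 A^T y] is nonzero, and for it the lower bound on [e^T E[Z] e] meets
    the upper bound [qform B e]. *)
Lemma lambda_min_plus_le1 : A != 0 -> lambda_min_plus W <= 1.
Proof.
move=> A0; have Bu := posdef_unitmx Bpos.
have [y Ay] : exists y : 'cV[R]_m, A^T *m y != 0.
  apply: contrapT => h; move/eqP: A0; apply; apply: trmx_inj; rewrite trmx0.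
  apply/matrixP => i j; have : A^T *m delta_mx j (0 : 'I_1) = 0.
    by apply/eqP/negPn/negP => Aj; apply: h; exists (delta_mx j 0).
  by rewrite -colE => /colP/(_ i); rewrite !mxE.
pose e := invmx B *m (A^T *m y).
have e0 : e != 0.
  by apply: contra_neq Ay => e0; rewrite -[_ *m y](mulKVmx Bu) -/e e0 mulmx0.
have Be : B *m e = A^T *m y by rewrite mulKVmx.
have := le_trans (lambda_min_plus_EZ Be) (qform_EZ_le e).
by rewrite ger_pMl //; case: Bpos => _; apply.
Qed.
End ExpectedSketch.

(** * Independence, almost-sure comparison and measurability *)

Section Independence.
Context d (T : measurableType d) (R : realType) (P : probability T R).
Context dU (U : measurableType dU) (D : probability U R).
Variables (G : set (set T)) (Y : T -> U).
Hypothesis mG : G `<=` measurable.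
Hypothesis mY : measurable_fun setT Y.
Hypothesis lawY : forall E, measurable E -> P (Y @^-1` E) = D E.
Hypothesis indep : forall F E, <<s G >> F -> measurable E ->
  P (F `&` Y @^-1` E) = (P F * P (Y @^-1` E))%E.

Local Notation T1 := (g_sigma_algebraType G).

(** The first factor is the sample space with the sigma-algebra generated by [G]. By independence
    the law of [w |-> (w, Y w)] agrees with a product on rectangles, hence everywhere, and Tonelli
    separates the variables. *)
Lemma ge0_integral_indep (f : T1 * U -> \bar R) :
  measurable_fun setT f -> (forall z, (0 <= f z)%E) ->
  (\int[P]_w f (w, Y w) = \int[P]_w \int[D]_u f (w, u))%E.
Proof.
move=> mf f0.
have sG : <<s G >> `<=` (measurable : set (set T)).
  by apply: smallest_sub => //; exact: sigma_algebra_measurable.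
pose i : T -> T1 := id.
have mi : measurable_fun setT i by move=> _ F mF; rewrite setTI; exact: sG.
pose j (w : T) : T1 * U := (i w, Y w).
have mj : measurable_fun setT j by apply: measurable_fun_pair.
pose P1 := distribution P (mfun_Sub (mem_set mi)).
pose PJ := distribution P (mfun_Sub (mem_set mj)).
have lawJ X : measurable X -> (P1 \x D)%E X = PJ X.
  apply: product_measure_unique => F E mF mE.
  by have := indep mF mE; rewrite lawY.
have := ge0_integral_pushforward mj P measurableT mf (fun z _ => f0 z).
rewrite preimage_setT => <-.
transitivity (\int[(P1 \x D)%E]_z f z)%E.
  by apply: eq_measure_integral => X mX _; have := lawJ X mX.
rewrite fubini_tonelli1 //.
have mF := measurable_fun_fubini_tonelli_F (m2 := D) f mf f0.
by rewrite (ge0_integral_pushforward mi P measurableT mF) // => w _; exact: integral_ge0.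
Qed.

End Independence.

(* f need not be measurable: the integral of a nonnegative function is a supremum over the
   simple functions below it, which is monotone regardless. *)
Lemma ae_ge0_le_integral_nonmeasurable d (T : measurableType d) (R : realType)
  (mu : {measure set T -> \bar R}) (f g : T -> \bar R) :
  (forall w, 0 <= f w)%E -> (forall w, 0 <= g w)%E -> measurable_fun setT g ->
  {ae mu, forall w, (f w <= g w)%E} -> (\int[mu]_w f w <= \int[mu]_w g w)%E.
Proof.
move=> f0 g0 mg [N [mN N0 fgN]].
(* The value [+oo] on the null set [N] makes the domination hold everywhere without changing the
   integral. *)
pose h w := if w \in N then +oo%E else g w.
have mh : measurable_fun setT h.
  apply: measurable_fun_ifT => //.
  apply: (measurable_fun_bool true); rewrite setTI.
  by rewrite (_ : _ @^-1` _ = N) //; apply/seteqP; split=> w /=; [move/set_mem|move/mem_set].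
have h0 w : (0 <= h w)%E by rewrite /h; case: ifP.
have fh w : (f w <= h w)%E.
  rewrite /h; case: ifPn => [_|]; first by rewrite leey.
  by rewrite notin_setE => nN; apply: contrapT => nfg; apply: nN; exact: fgN.
have -> : (\int[mu]_w g w = \int[mu]_w h w)%E.
  apply: ge0_ae_eq_integral => //.
  exists N; split=> // w /= /not_implyP[_] nE; apply: contrapT => nN; apply: nE.
  by rewrite /h ifF //; apply/negbTE; rewrite notin_setE.
rewrite !ge0_integralTE //.
apply: le_ereal_sup => _ [k /= kf <-]; exists k => // w.
exact: le_trans (kf w) (fh w).
Qed.

Lemma ae_exists d (T : measurableType d) (R : realType) (P : probability T R)
  (Q : T -> Prop) : {ae P, forall w, Q w} -> exists w, Q w.
Proof.
move=> [N [mN N0 QN]]; apply: contrapT => nQ.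
have NT : N = setT.
  by apply/seteqP; split=> // w _; apply: QN => Qw; apply: nQ; exists w.
by move/eqP: N0; rewrite NT probability_setT onee_eq0.
Qed.

Lemma measurable_qform d (T : measurableType d) (R : realType) p
  (M : T -> 'M[R]_p) (v : T -> 'cV[R]_p) :
  (forall i j, measurable_fun setT (fun w => M w i j)) ->
  (forall i, measurable_fun setT (fun w => v w i 0)) ->
  measurable_fun setT (fun w => qform (M w) (v w)).
Proof.
move=> mM mv; under eq_fun do rewrite qform_sum.
apply: measurable_sum => i; apply: measurable_sum => j.
by apply: measurable_funM => //; apply: measurable_funM.
Qed.

(** * The expected contraction, by induction on the iteration *)

Unset Implicit Arguments.

Theorem mainTheorem12
  (R : realType) (m n : nat)
  (A : 'M[R]_(m, n)) (b : 'cV[R]_m) (B : 'M[R]_n)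
  (* probability space *)
  (d : measure_display) (Omega : measurableType d) (P : probability Omega R)
  (* sketch space: U carries the sketch distribution D; mat u is the sketch matrix *)
  (dU : measure_display) (U : measurableType dU) (D : probability U R)
  (mat : U -> sketch R m)
  (Sk : nat -> Omega -> U)                 (* S_k *)
  (rho : U -> R) (theta : R) (r : nat)     (* rho_S, theta, r *)
  (lam : nat -> Omega -> nat -> R)        (* lambda_r^k *)
  (x : nat -> Omega -> 'cV[R]_n)          (* x^k *)
  (x0 xstar : 'cV[R]_n) :
  (exists z : 'cV[R]_n, A *m z = b) ->                      (* consistency *)
  posdef_mx B ->                                            (* B SPD *)
  (forall i j, D.-integrable setT (fun u => ((Zsk A B (mat u)) i j)%:E)) -> (* E[Z] finite *)
  (forall v : 'cV[R]_n, (EZ A B D mat *m v == 0) = (A *m v == 0)) -> (* exactness *)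
  A != 0 ->
  (* S_k i.i.d. with law D *)
  (forall k, measurable_fun setT (Sk k)) ->
  (forall k (E : set U), measurable E -> P (Sk k @^-1` E) = D E) ->
  mutually_indep P Sk ->
  (* S_k independent of x^k *)
  (forall k, indep_sigma P (gen_cV (x k)) (gen_rv (Sk k))) ->
  (* the iterates are random vectors, the inner outputs random vectors *)
  (forall k (i : 'I_n), measurable_fun setT (fun w => x k w i ord0)) ->
  (forall k i, measurable_fun setT (fun w => lam k w i)) ->
  (forall u, 0 < rho u < 1) ->
  theta < 1 ->
  (forall k, {ae P, forall w, rho (Sk k w) <= theta}) ->
  (forall k (F : set Omega),
      <<s gen_cV (x k) `|` gen_rv (Sk k) >> F ->
      (\int[P]_(w in F) (inner_err A B b (x k w) (mat (Sk k w)) (lam k w))%:E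
       <= \int[P]_(w in F) (rho (Sk k w) ^+ r
                              * inner_init A B b (x k w) (mat (Sk k w)))%:E)%E) ->
  (* the iteration *)
  (forall w, x 0 w = x0) ->
  (forall k w, x k.+1 w = x k w + step A B (mat (Sk k w)) (lam k w)) ->
  is_B_proj A B b x0 xstar ->
  forall k : nat,
    (\int[P]_w (qform B (x k w - xstar))%:E
     <= (((1 - (1 - theta ^+ r)
             * lambda_min_plus (invmx (spd_sqrt B) *m EZ A B D mat *m invmx (spd_sqrt B))) ^+ k)
         * qform B (x0 - xstar))%:E)%E.
Proof.
move=> _ Bpos Zint exactZ A0 mSk lawSk _ indep mx mlam rho01 theta1 rhole inner x00 xS projx k.
have Axs : A *m xstar = b by case: projx.
set W := _ *m _ *m _; set l := lambda_min_plus W.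
pose Z u := Zsk A B (mat u).
pose e k w := x k w - xstar.
pose q k w := qform B (e k w).
pose z k w := qform (Z (Sk k w)) (e k w).
pose er k w := inner_err A B b (x k w) (mat (Sk k w)) (lam k w).
have q0 j w : 0 <= q j w by exact: posdef_ge0.
have z0 j w : 0 <= z j w by exact: qform_Zsk_ge0.
have er0 j w : 0 <= er j w by exact: inner_err_ge0.
have stepE j w : q j.+1 w + z j w = q j w + er j w.
  by rewrite /q /e xS (step_error Bpos _ _ _ Axs).
have range j w : exists y : 'cV[R]_m, B *m e j w = A^T *m y.
  elim: j => [|j [y IH]]; first by rewrite /e x00; exact: is_B_proj_range projx.
  have [y' hy'] := step_range A Bpos (mat (Sk j w)) (lam j w).
  by exists (y + y'); rewrite /e xS addrAC mulmxDr -/(e j w) IH hy' mulmxDr.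
have me j i : measurable_fun setT (fun w => e j w i 0).
  rewrite (_ : (fun _ => _) = (fun w => x j w i 0 - xstar i 0)).
    by apply: measurable_funB => //; exact: mx.
  by apply/funext => w; rewrite !mxE.
have mZ i j : measurable_fun setT (fun u => Z u i j).
  by have /measurable_int/measurable_EFinP := Zint i j.
have mq j : measurable_fun setT (q j) by apply: measurable_qform => // i; exact: me.
have mz j : measurable_fun setT (z j).
  apply: measurable_qform => [i i'|i]; last exact: me.
  exact: measurableT_comp (mZ i i') (mSk j).
(* The inner system changes size with the sketch, so measurability of its error is read off the step
   identity. *)
have mer j : measurable_fun setT (er j).
  rewrite (_ : er j = (fun w => q j.+1 w + z j w - q j w)).
    by apply: measurable_funB => //; apply: measurable_funD.
  by apply/funext => w; rewrite stepE addrC addKr.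
have Ez j : (\int[P]_w (z j w)%:E = \int[P]_w (qform (EZ A B D mat) (e j w))%:E)%E.
  have mG : gen_cV (x j) `<=` measurable.
    by move=> _ [i [E mE ->]]; rewrite -[_ @^-1` _]setTI; exact: mx.
  have iP F E : <<s gen_cV (x j) >> F -> measurable E ->
      P (F `&` Sk j @^-1` E) = (P F * P (Sk j @^-1` E))%E.
    move=> sF mE; apply: (indep j) => //; apply: sub_sigma_algebra.
    by exists E.
  pose f (wu : g_sigma_algebraType (gen_cV (x j)) * U) := (qform (Z wu.2) (e j wu.1))%:E.
  have mf : measurable_fun setT f.
    apply/measurable_EFinP; apply: measurable_qform => [i i'|i].
      exact: measurableT_comp (mZ i i') measurable_snd.
    (* The error must be measurable for the sigma-algebra generated by [x^j], not just the ambient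
       one. *)
    pose ei (w : g_sigma_algebraType (gen_cV (x j))) : R := e j w i 0.
    apply: (@measurableT_comp _ _ _ _ _ _ ei) => //; rewrite /ei.
    rewrite (_ : (fun _ => _) = (fun w => x j w i 0 - xstar i 0)).
      apply: measurable_funB => // _ E mE; rewrite setTI.
      by apply: sub_sigma_algebra; exists i, E.
    by apply/funext => w; rewrite !mxE.
  rewrite (ge0_integral_indep mG (mSk j) (lawSk j) iP mf).
    by apply: eq_integral => w _; rewrite /f /=; exact: integral_qform_Zsk.
  by move=> wu; rewrite lee_fin qform_Zsk_ge0.
(* Some sample point satisfies [0 < rho <= theta]. *)
have theta0 : 0 <= theta.
  have [w hw] := ae_exists (rhole 0%N).
  by apply: le_trans hw; case/andP: (rho01 (Sk 0%N w)) => /ltW.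
have Eer j : (\int[P]_w (er j w)%:E <= (theta ^+ r)%:E * \int[P]_w (z j w)%:E)%E.
  (* Taking [F] to be the whole space gives the bound for full expectations. *)
  apply: le_trans (inner j setT _) _.
    have := sigma_algebraCD (@sigma_algebra0 _ setT (gen_cV (x j) `|` gen_rv (Sk j))).
    by rewrite setD0.
  rewrite -ge0_integralZl_EFin //; last 3 first.
  - by move=> w _; rewrite lee_fin.
  - exact/measurable_EFinP.
  - by rewrite exprn_ge0.
  (* No measurability of [rho] is at hand, hence this form of monotonicity. *)
  apply: ae_ge0_le_integral_nonmeasurable.
  - move=> w; rewrite lee_fin mulr_ge0 ?exprn_ge0 ?(inner_initE Bpos _ _ Axs) //.
      by case/andP: (rho01 (Sk j w)) => /ltW.
    exact: qform_Zsk_ge0.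
  - by move=> w; rewrite -EFinM lee_fin mulr_ge0 ?exprn_ge0.
  - by apply/measurable_EFinP; apply: measurable_funM.
  apply: filterS (rhole j) => w hw.
  rewrite -EFinM lee_fin (inner_initE Bpos _ _ Axs); apply: ler_wpM2r; first exact: z0.
  by rewrite lerXn2r // nnegrE; case/andP: (rho01 (Sk j w)) => /ltW.
have l0 : 0 <= l by exact: lambda_min_plus_ge0.
have l1 : l <= 1 by exact: lambda_min_plus_le1.
have th1 : theta ^+ r <= 1 by rewrite exprn_ile1 // ltW.
have thr0 : 0 <= theta ^+ r by rewrite exprn_ge0.
set c := 1 - _.
(* The induction step multiplies the bound for [k] by [c]; this is where [l <= 1] enters. *)
have c0 : 0 <= c.
  by rewrite subr_ge0 mulr_ile1 // ?subr_ge0 // gerBl.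
elim: k => [|k IH].
  rewrite expr0 mul1r; under eq_integral do rewrite x00.
  by rewrite integral_cst // [X in (_ * X)%E]probability_setT mule1.
(* Finiteness, supplied by the induction bound, allows the cancellation to be done in [R]. *)
have Eq_fin j : (\int[P]_w (q j w)%:E <= (c ^+ j * qform B (x0 - xstar))%:E)%E ->
  (\int[P]_w (q j w)%:E)%E \is a fin_num.
  move=> h; rewrite ge0_fin_numE; first exact: le_lt_trans h (ltry _).
  by apply: integral_ge0 => w _; rewrite lee_fin.
have Iq := Eq_fin k IH.
have zq : (\int[P]_w (z k w)%:E <= \int[P]_w (q k w)%:E)%E.
  apply: ge0_le_integral => //; try by move=> w _; rewrite lee_fin.
  - exact/measurable_EFinP.
  - exact/measurable_EFinP.
  - by move=> w _; rewrite lee_fin; exact: qform_Zsk_le.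
have Iz : (\int[P]_w (z k w)%:E)%E \is a fin_num.
  rewrite ge0_fin_numE; last by apply: integral_ge0 => w _; rewrite lee_fin.
  by apply: le_lt_trans zq _; rewrite ltey_eq Iq.
have lz : (l%:E * \int[P]_w (q k w)%:E <= \int[P]_w (z k w)%:E)%E.
  rewrite Ez -ge0_integralZl_EFin //; last 2 first.
  - by move=> w _; rewrite lee_fin.
  - exact/measurable_EFinP.
  apply: ge0_le_integral => //.
  - by move=> w _; rewrite -EFinM lee_fin mulr_ge0.
  - by apply/measurable_EFinP; apply: measurable_funM.
  - by apply/measurable_EFinP; apply: measurable_qform => // i; exact: me.
  - move=> w _; rewrite -EFinM lee_fin; have [y hy] := range k w.
    exact: (lambda_min_plus_EZ Bpos Zint exactZ hy).
have tot : (\int[P]_w (q k.+1 w)%:E + \int[P]_w (z k w)%:E =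
            \int[P]_w (q k w)%:E + \int[P]_w (er k w)%:E)%E.
  rewrite -!ge0_integralD //; try by [move=> w _; rewrite lee_fin|exact/measurable_EFinP].
  by apply: eq_integral => w _; rewrite -!EFinD stepE.
have Hq : (\int[P]_w (q k.+1 w)%:E + \int[P]_w (z k w)%:E <=
           \int[P]_w (q k w)%:E + (theta ^+ r)%:E * \int[P]_w (z k w)%:E)%E.
  by rewrite tot leeD2l.
have Iq1 : (\int[P]_w (q k.+1 w)%:E)%E \is a fin_num.
  rewrite ge0_fin_numE; last by apply: integral_ge0 => w _; rewrite lee_fin.
  apply: (@le_lt_trans _ _ (\int[P]_w (q k.+1 w)%:E + \int[P]_w (z k w)%:E)%E).
    by rewrite leeDl // integral_ge0 // => w _; rewrite lee_fin.
  apply: le_lt_trans Hq _.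
  by rewrite -(fineK Iq) -(fineK Iz) -EFinM -EFinD ltry.
move: IH Hq lz; rewrite -/(q k) -/(q k.+1) -(fineK Iq) -(fineK Iz) -(fineK Iq1).
rewrite -!EFinM -!EFinD !lee_fin exprS -mulrA.
set a := fine _; set a1 := fine _; set t := fine _ => IH Hq lz.
apply: (@le_trans _ _ (c * a)); last exact: ler_wpM2l.
(* From [a1 + t <= a + theta^r t] and [l a <= t] follows [a1 <= a - (1 - theta^r) t <= c a]. *)
have : (1 - theta ^+ r) * (l * a) <= (1 - theta ^+ r) * t.
  by rewrite ler_wpM2l // subr_ge0.
rewrite /c; lra.
Qed.
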